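(* Let $U,V\subset(0,\infty)$ be non-empty open sets and let $f\colon(0,\infty)\to\mathbb{R}$ be continuous such that $(f(ku+v))_{k\ge1}\in\mathcal{G}$ for all $u\in U$, $v\in V$. Then there exist an integer $n\ge1$, rationals $q_1,\dots,q_n$ not all zero, and non-empty open intervals $U'\subset U$, $V'\subset V$ such that $$\sum_{k=1}^n q_k\, f(ku+v)=0\quad\text{for all } u\in U',\ v\in V'.$$
   Context: A sequence of real numbers $(a_k)_{k\ge1}$ is called pointwise good (written $(a_k)\in\mathcal{G}$) if for every measure preserving flow $(U_t)_{t\in\mathbb{R}}$ on a probability space $(X,\mathcal{B},\mu)$ (a measurable action of $\mathbb{R}$ by measure preserving transformations) and every $F\in L^\infty(X,\mu)$, the averages $\frac1n\sum_{k=1}^n F(U_{a_k}x)$ converge for $\mu$-almost every $x$ as $n\to\infty$. It may be used that every sequence in $\mathcal{G}$ is linearly dependent over $\mathbb{Q}$, i.e. some nontrivial finite $\mathbb{Q}$-linear combination of its terms vanishes. *)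

(* Defs.v *)
From Stdlib Require Import Reals QArith Qreals.
Open Scope R_scope.

Fixpoint sum1 (n : nat) (g : nat -> R) : R :=
  match n with O => 0 | S m => sum1 m g + g (S m) end.

Definition sigma_algebra {X : Type} (B : (X -> Prop) -> Prop) : Prop :=
  B (fun _ => True) /\
  (forall A, B A -> B (fun x => ~ A x)) /\
  (forall A : nat -> X -> Prop, (forall n, B (A n)) -> B (fun x => exists n, A n x)).

Definition generated {X : Type} (S : (X -> Prop) -> Prop) (A : X -> Prop) : Prop :=
  forall B : (X -> Prop) -> Prop, sigma_algebra B -> (forall E, S E -> B E) -> B A.

Definition borel : (R -> Prop) -> Prop := generated open_set.

Definition prod_sigma {X : Type} (B : (X -> Prop) -> Prop) : (R * X -> Prop) -> Prop :=
  generated (fun P => exists A E, borel A /\ B E /\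
                       forall p, P p <-> (A (fst p) /\ E (snd p))).

Definition prob_measure {X : Type} (B : (X -> Prop) -> Prop) (mu : (X -> Prop) -> R) : Prop :=
  (forall A, B A -> 0 <= mu A) /\
  mu (fun _ => True) = 1 /\
  (forall A : nat -> X -> Prop,
     (forall n, B (A n)) ->
     (forall n m x, n <> m -> A n x -> A m x -> False) ->
     infinite_sum (fun n => mu (A n)) (mu (fun x => exists n, A n x))).

Definition mp_flow {X : Type} (B : (X -> Prop) -> Prop) (mu : (X -> Prop) -> R)
  (U : R -> X -> X) : Prop :=
  (forall x, U 0 x = x) /\
  (forall s t x, U (s + t) x = U s (U t x)) /\
  (forall E, B E -> prod_sigma B (fun p => E (U (fst p) (snd p)))) /\
  (forall t E, B E -> B (fun x => E (U t x)) /\ mu (fun x => E (U t x)) = mu E).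

Definition Linfty {X : Type} (B : (X -> Prop) -> Prop) (mu : (X -> Prop) -> R)
  (F : X -> R) : Prop :=
  (forall A, borel A -> B (fun x => A (F x))) /\
  exists M N, B N /\ mu N = 1 /\ forall x, N x -> Rabs (F x) <= M.

(* pointwise good sequences (a_k)_{k>=1}; a 0 is irrelevant *)
Definition good (a : nat -> R) : Prop :=
  forall (X : Type) (B : (X -> Prop) -> Prop) (mu : (X -> Prop) -> R) (U : R -> X -> X)
         (F : X -> R),
    sigma_algebra B -> prob_measure B mu -> mp_flow B mu U -> Linfty B mu F ->
    exists N, B N /\ mu N = 1 /\
      forall x, N x -> exists l,
        Un_cv (fun n => sum1 (S n) (fun k => F (U (a k) x)) / INR (S n)) l.

Definition Q_lin_dep (a : nat -> R) : Prop :=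
  exists (n : nat) (q : nat -> Q),
    (exists k, (1 <= k <= n)%nat /\ ~ (q k == 0)%Q) /\
    sum1 n (fun k => Q2R (q k) * a k) = 0.

(* Main.v *)
(* The zero set of each function (u, v) |-> sum_k q_k f(k u + v) is closed, and
   since good sequences are Q-linearly dependent, every point of U x V lies in the
   zero set of some nontrivial rational combination.  There are only countably
   many such combinations, so by the Baire category argument (nested closed boxes)
   one of these zero sets has interior in U x V. *)
Require Import Defs.
From Stdlib Require Import Reals QArith Qreals Lra Lia ZArith Cantor Classical ClassicalEpsilon.
From Coquelicot Require Import Coquelicot.
Open Scope R_scope.

Lemma sum1_ext n g h :
  (forall k, (1 <= k <= n)%nat -> g k = h k) -> sum1 n g = sum1 n h.
Proof.
  induction n as [|n IH]; intros Hgh; simpl; [reflexivity|].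
  rewrite IH, Hgh; [reflexivity | lia | intros; apply Hgh; lia].
Qed.

Definition nontrivial (n : nat) (q : nat -> Q) : Prop :=
  exists k, (1 <= k <= n)%nat /\ ~ (q k == 0)%Q.

Definition lincomb (f : R -> R) (n : nat) (q : nat -> Q) (u v : R) : R :=
  sum1 n (fun k => Q2R (q k) * f (INR k * u + v)).

Lemma continuity_2d_pt_lincomb f n q u v :
  (forall x, 0 < x -> continuity_pt f x) -> 0 < u -> 0 < v ->
  continuity_2d_pt (lincomb f n q) u v.
Proof.
  intros Hf Hu Hv; unfold lincomb; induction n as [|n IH]; simpl.
  - apply continuity_2d_pt_const.
  - apply continuity_2d_pt_plus; [exact IH|].
    apply continuity_2d_pt_mult; [apply continuity_2d_pt_const|].
    apply (continuity_1d_2d_pt_comp f (fun x y => INR (S n) * x + y)).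
    + apply Hf; pose proof (pos_INR (S n)); nra.
    + apply continuity_2d_pt_plus; [|apply continuity_2d_pt_id2].
      apply continuity_2d_pt_mult; [apply continuity_2d_pt_const|apply continuity_2d_pt_id1].
Qed.

Definition nat_to_Z (c : nat) : Z :=
  let (a, b) := Cantor.of_nat c in (Z.of_nat a - Z.of_nat b)%Z.

Lemma nat_to_Z_surj z : exists c, nat_to_Z c = z.
Proof.
  destruct (Z_le_gt_dec 0 z).
  - exists (Cantor.to_nat (Z.to_nat z, 0%nat)).
    unfold nat_to_Z; rewrite Cantor.cancel_of_to; lia.
  - exists (Cantor.to_nat (0%nat, Z.to_nat (- z))).
    unfold nat_to_Z; rewrite Cantor.cancel_of_to; lia.
Qed.

Definition nat_to_Q (c : nat) : Q :=
  let (a, b) := Cantor.of_nat c in nat_to_Z a # Pos.of_succ_nat b.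

Lemma nat_to_Q_surj r : exists c, nat_to_Q c = r.
Proof.
  destruct r as [z p]; destruct (nat_to_Z_surj z) as [a Ha].
  exists (Cantor.to_nat (a, pred (Pos.to_nat p))).
  unfold nat_to_Q; rewrite Cantor.cancel_of_to, Ha; f_equal.
  apply SuccNat2Pos.inv; pose proof (Pos2Nat.is_pos p); lia.
Qed.

(* Only the coordinates 1..n of [nat_to_Qvec n c] are meaningful. *)
Fixpoint nat_to_Qvec (n c : nat) : nat -> Q :=
  match n with
  | O => fun _ => 0%Q
  | S l => let (a, c') := Cantor.of_nat c in
           fun k => if Nat.eqb k (S l) then nat_to_Q a else nat_to_Qvec l c' k
  end.

Lemma nat_to_Qvec_surj n (q : nat -> Q) :
  exists c, forall k, (1 <= k <= n)%nat -> nat_to_Qvec n c k = q k.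
Proof.
  induction n as [|n IH].
  - exists 0%nat; intros; lia.
  - destruct IH as [c Hc]; destruct (nat_to_Q_surj (q (S n))) as [a Ha].
    exists (Cantor.to_nat (a, c)); intros k Hk; cbn [nat_to_Qvec]; rewrite Cantor.cancel_of_to.
    destruct (Nat.eqb_spec k (S n)) as [->|]; [exact Ha | apply Hc; lia].
Qed.

Definition coeff_enum (m : nat) : nat * (nat -> Q) :=
  let (n, c) := Cantor.of_nat m in (n, nat_to_Qvec n c).

Lemma coeff_enum_surj n (q : nat -> Q) :
  exists m, fst (coeff_enum m) = n /\
            forall k, (1 <= k <= n)%nat -> snd (coeff_enum m) k = q k.
Proof.
  destruct (nat_to_Qvec_surj n q) as [c Hc].
  exists (Cantor.to_nat (n, c)); unfold coeff_enum; rewrite Cantor.cancel_of_to.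
  split; [reflexivity | exact Hc].
Qed.

Lemma Q_lin_dep_enumerated (a : nat -> R) :
  Q_lin_dep a -> exists m, let (n, q) := coeff_enum m in
                           nontrivial n q /\ sum1 n (fun k => Q2R (q k) * a k) = 0.
Proof.
  intros [n [q [Hq Hsum]]]; destruct (coeff_enum_surj n q) as [m [Hn Hq']].
  exists m; destruct (coeff_enum m) as [n' q']; simpl in Hn, Hq'; subst n'; split.
  - destruct Hq as [k [Hk Hqk]]; exists k; rewrite Hq'; auto.
  - rewrite <- Hsum; apply sum1_ext; intros k Hk; rewrite Hq'; auto.
Qed.

Record box := Box { lo1 : R; hi1 : R; lo2 : R; hi2 : R }.

Definition in_box (b : box) (u v : R) : Prop :=
  lo1 b <= u <= hi1 b /\ lo2 b <= v <= hi2 b.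

Definition in_open_box (b : box) (u v : R) : Prop :=
  lo1 b < u < hi1 b /\ lo2 b < v < hi2 b.

Definition nondegenerate (b : box) : Prop := lo1 b < hi1 b /\ lo2 b < hi2 b.

Definition subbox (b' b : box) : Prop :=
  lo1 b <= lo1 b' /\ hi1 b' <= hi1 b /\ lo2 b <= lo2 b' /\ hi2 b' <= hi2 b.

Lemma nested_intervals_point (a b : nat -> R) :
  (forall m k, a m <= b k) -> exists x, forall m, a m <= x <= b m.
Proof.
  intros Hab.
  destruct (completeness (fun x => exists m, x = a m)) as [x [Hub Hlub]].
  - exists (b 0%nat); intros z [m ->]; apply Hab.
  - exists (a 0%nat), 0%nat; reflexivity.
  - exists x; intros m; split.
    + apply Hub; exists m; reflexivity.
    + apply Hlub; intros z [k ->]; apply Hab.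
Qed.

Lemma nested_boxes_point (bs : nat -> box) :
  (forall m, nondegenerate (bs m)) -> (forall m, subbox (bs (S m)) (bs m)) ->
  exists x y, forall m, in_box (bs m) x y.
Proof.
  intros Hnd Hsub.
  assert (Hmono : forall m k, (m <= k)%nat -> subbox (bs k) (bs m)).
  { intros m k Hmk; induction Hmk as [|k _ IH]; [unfold subbox; lra|].
    specialize (Hsub k); unfold subbox in *; lra. }
  assert (Hcross : forall m k, subbox (bs (m + k)%nat) (bs m) /\
                               subbox (bs (m + k)%nat) (bs k) /\ nondegenerate (bs (m + k)%nat)).
  { intros m k; repeat split; try apply Hnd; apply Hmono; lia. }
  destruct (nested_intervals_point (fun m => lo1 (bs m)) (fun m => hi1 (bs m))) as [x Hx].
  { intros m k; destruct (Hcross m k) as (? & ? & ?); unfold subbox, nondegenerate in *; lra. }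
  destruct (nested_intervals_point (fun m => lo2 (bs m)) (fun m => hi2 (bs m))) as [y Hy].
  { intros m k; destruct (Hcross m k) as (? & ? & ?); unfold subbox, nondegenerate in *; lra. }
  exists x, y; intros m; split; [apply Hx | apply Hy].
Qed.

Lemma countable_avoidance (b0 : box) (P : nat -> R -> R -> Prop) :
  nondegenerate b0 ->
  (forall m b, nondegenerate b -> subbox b b0 ->
     exists b', nondegenerate b' /\ subbox b' b /\ forall u v, in_box b' u v -> ~ P m u v) ->
  exists x y, in_box b0 x y /\ forall m, ~ P m x y.
Proof.
  intros Hb0 Hstep.
  (* The step relation is made total by being vacuous outside admissible boxes. *)
  destruct (choice (fun (mb : nat * box) b' =>
              nondegenerate (snd mb) -> subbox (snd mb) b0 ->
              nondegenerate b' /\ subbox b' (snd mb) /\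
              forall u v, in_box b' u v -> ~ P (fst mb) u v)) as [next Hnext].
  { intros [m b]; destruct (classic (nondegenerate b /\ subbox b b0)) as [[Hb Hsub]|Hno].
    - destruct (Hstep m b Hb Hsub) as [b' Hb']; exists b'; intros; exact Hb'.
    - exists b; intros Hb Hsub; tauto. }
  set (bs := fix bs m := match m with O => b0 | S k => next (k, bs k) end).
  assert (Hbs : forall m, nondegenerate (bs m) /\ subbox (bs m) b0).
  { induction m as [|m [Hnd Hsub]]; [simpl; split; [exact Hb0 | unfold subbox; lra]|].
    destruct (Hnext (m, bs m) Hnd Hsub) as (Hnd' & Hsub' & _).
    split; [exact Hnd' | unfold subbox in *; simpl in *; lra]. }
  destruct (nested_boxes_point bs) as [x [y Hxy]].
  - intros m; apply Hbs.
  - intros m; apply (Hnext (m, bs m)); apply Hbs.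
  - exists x, y; split; [exact (Hxy 0%nat)|].
    intros m; destruct (Hbs m) as [Hnd Hsub].
    apply (Hnext (m, bs m) Hnd Hsub); exact (Hxy (S m)).
Qed.

Lemma vanishing_or_zero_free_subbox (g : R -> R -> R) (b : box) :
  nondegenerate b -> (forall u v, in_open_box b u v -> continuity_2d_pt g u v) ->
  (forall u v, in_open_box b u v -> g u v = 0) \/
  exists b', nondegenerate b' /\ subbox b' b /\ forall u v, in_box b' u v -> g u v <> 0.
Proof.
  intros Hb Hg; destruct (classic (forall u v, in_open_box b u v -> g u v = 0)) as [|Hnz];
    [left; assumption | right].
  apply not_all_ex_not in Hnz as [u Hnz]; apply not_all_ex_not in Hnz as [v Hnz].
  apply imply_to_and in Hnz as [Huv Hguv].
  destruct (continuity_2d_pt_neq_0 g u v (Hg u v Huv) Hguv) as [d Hd].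
  destruct Huv as [Hu Hv]; pose proof (cond_pos d).
  pose proof (Rmin_l (u - lo1 b) (hi1 b - u)); pose proof (Rmin_r (u - lo1 b) (hi1 b - u)).
  pose proof (Rmin_l (v - lo2 b) (hi2 b - v)); pose proof (Rmin_r (v - lo2 b) (hi2 b - v)).
  set (r1 := Rmin (u - lo1 b) (hi1 b - u)) in *; set (r2 := Rmin (v - lo2 b) (hi2 b - v)) in *.
  set (r := Rmin d (Rmin r1 r2) / 2).
  assert (Hr : 0 < r /\ r < d /\ r < r1 /\ r < r2).
  { assert (0 < r1) by (apply Rmin_glb_lt; lra); assert (0 < r2) by (apply Rmin_glb_lt; lra).
    pose proof (Rmin_l d (Rmin r1 r2)); pose proof (Rmin_r d (Rmin r1 r2)).
    pose proof (Rmin_l r1 r2); pose proof (Rmin_r r1 r2).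
    assert (0 < Rmin d (Rmin r1 r2)) by (repeat apply Rmin_glb_lt; lra).
    unfold r; lra. }
  exists (Box (u - r) (u + r) (v - r) (v + r)); unfold nondegenerate, subbox, in_box; simpl.
  split; [split; lra | split; [repeat split; lra |]].
  intros x y [Hx Hy]; apply Hd; apply Rabs_def1; lra.
Qed.

Lemma open_sets_contain_box (U V : R -> Prop) u v :
  open_set U -> open_set V -> U u -> V v ->
  exists b, nondegenerate b /\ forall x y, in_box b x y -> U x /\ V y.
Proof.
  intros HU HV Hu Hv; destruct (HU u Hu) as [d1 Hd1], (HV v Hv) as [d2 Hd2].
  pose proof (cond_pos d1); pose proof (cond_pos d2).
  exists (Box (u - d1 / 2) (u + d1 / 2) (v - d2 / 2) (v + d2 / 2)).
  unfold nondegenerate, in_box; simpl; split; [lra|].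
  intros x y [Hx Hy]; split; [apply Hd1 | apply Hd2]; unfold disc; apply Rabs_def1; lra.
Qed.

Theorem mainTheorem6
  (Gdep : forall a : nat -> R, good a -> Q_lin_dep a)
  (U V : R -> Prop) (f : R -> R)
  (HUo : open_set U) (HVo : open_set V)
  (HUne : exists u, U u) (HVne : exists v, V v)
  (HUpos : forall u, U u -> 0 < u) (HVpos : forall v, V v -> 0 < v)
  (Hf : forall x, 0 < x -> continuity_pt f x)
  (HG : forall u v, U u -> V v -> good (fun k => f (INR k * u + v))) :
  exists (n : nat) (q : nat -> Q) (a1 b1 a2 b2 : R),
    (1 <= n)%nat /\
    (exists k, (1 <= k <= n)%nat /\ ~ (q k == 0)%Q) /\
    a1 < b1 /\ a2 < b2 /\
    (forall u, a1 < u < b1 -> U u) /\ (forall v, a2 < v < b2 -> V v) /\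
    (forall u v, a1 < u < b1 -> a2 < v < b2 ->
       sum1 n (fun k => Q2R (q k) * f (INR k * u + v)) = 0).
Proof.
  apply NNPP; intros Hneg.
  destruct HUne as [u0 Hu0], HVne as [v0 Hv0].
  destruct (open_sets_contain_box U V u0 v0 HUo HVo Hu0 Hv0) as [b0 [Hb0 HUV]].
  destruct (countable_avoidance b0 (fun m x y => let (n, q) := coeff_enum m in
              nontrivial n q /\ lincomb f n q x y = 0) Hb0) as [x [y [Hxy HP]]].
  - intros m b Hb Hsub; destruct (coeff_enum m) as [n q].
    assert (HUVb : forall u v, in_open_box b u v -> U u /\ V v).
    { intros u v [Hu Hv]; apply HUV; unfold subbox, in_box in *; lra. }
    destruct (classic (nontrivial n q)) as [Hq|Hq].
    2: { exists b; split; [exact Hb | split; [unfold subbox; lra | tauto]]. }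
    destruct (vanishing_or_zero_free_subbox (lincomb f n q) b Hb) as [Hvan | [b' Hb']].
    + intros u v Huv; destruct (HUVb u v Huv).
      apply continuity_2d_pt_lincomb; auto.
    + exfalso; apply Hneg; exists n, q, (lo1 b), (hi1 b), (lo2 b), (hi2 b).
      destruct Hb as [Hb1 Hb2]; pose proof Hq as [k [Hk _]].
      split; [lia | split; [exact Hq | split; [exact Hb1 | split; [exact Hb2 | split; [|split]]]]].
      * intros u Hu; apply (HUVb u ((lo2 b + hi2 b) / 2)); split; [exact Hu | lra].
      * intros v Hv; apply (HUVb ((lo1 b + hi1 b) / 2) v); split; [lra | exact Hv].
      * intros u v Hu Hv; apply Hvan; split; assumption.
    + exists b'; intuition eauto.
  - destruct (HUV x y Hxy) as [Ux Vy].
    destruct (Q_lin_dep_enumerated _ (Gdep _ (HG x y Ux Vy))) as [m Hm].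
    exact (HP m Hm).
Qed.
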